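(* Let $(\mathcal M,\phi,\xi,\eta,g)$ be an $\alpha$-Sasakian manifold which is a twisted $\eta$-Ricci soliton: there are a vector field $X$ and real constants $\lambda,C_1,C_2$ with $$Ric+\tfrac12\mathcal L_Xg=\lambda g+2C_1\,\alpha_X\odot\eta+C_2\,\eta\otimes\eta,\qquad \alpha_X=\mathcal L_X\eta,\qquad \eta(X)=0.$$ Let $a,b>0$ be real numbers and let $(\mathcal M,\phi,\xi',\eta',g')$ be the image of this structure under the $\mathcal D_{a,b}$-homothety, i.e. $$\xi'=\tfrac1b\xi,\qquad \eta'=b\,\eta,\qquad g'=a\,g+(b^2-a)\,\eta\otimes\eta.$$ Then $(\mathcal M,\phi,\xi',\eta',g')$ is also a twisted $\eta$-Ricci soliton: there are a vector field $X'$ and real constants $\lambda',C_1',C_2'$ such that $$Ric'+\tfrac12\mathcal L_{X'}g'=\lambda'g'+2C_1'\,\alpha'_{X'}\odot\eta'+C_2'\,\eta'\otimes\eta',\qquad \alpha'_{X'}=\mathcal L_{X'}\eta',\qquad \eta'(X')=0,$$ where $Ric'$ is the Ricci tensor of $g'$.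
   Context: An almost contact metric structure $(\phi,\xi,\eta,g)$ on a connected manifold of dimension $2n+1\ge3$ satisfies $\phi^2X=-X+\eta(X)\xi$, $\eta(\xi)=1$, $g(\phi X,\phi Y)=g(X,Y)-\eta(X)\eta(Y)$. It is called $\alpha$-Sasakian if $(\nabla_X\phi)Y=\alpha\,(g(X,Y)\xi-\eta(Y)X)$ for some non-zero real constant $\alpha$, where $\nabla$ is the Levi-Civita connection of $g$. $Ric$ is the Ricci tensor of $g$, $\mathcal L$ the Lie derivative, and $\odot$ the symmetric tensor product, $\theta\odot\eta=\tfrac12(\theta\otimes\eta+\eta\otimes\theta)$. *)

(* Defs.v *)
From HB Require Import structures.
From mathcomp Require Import all_boot all_order all_algebra.
From mathcomp Require Import all_classical all_reals all_analysis.

Set Implicit Arguments.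
Unset Strict Implicit.
Unset Printing Implicit Defensive.

Import Order.TTheory GRing.Theory Num.Theory.
Import numFieldNormedType.Exports.

Local Open Scope classical_set_scope.
Local Open Scope ring_scope.

(* [iter_partial [:: j1; ...; jk] f] is the iterated partial derivative
   d_j1 ... d_jk f on R^m. *)
Fixpoint iter_partial (R : realType) (m : nat) (s : seq 'I_m)
    (f : 'rV[R]_m -> R) : 'rV[R]_m -> R :=
  if s is j :: s' then fun x => 'D_(delta_mx 0 j) (iter_partial s' f) x else f.

(* C^oo on an open set U; the values of f outside U are irrelevant. *)
Definition smooth_on (R : realType) (m : nat) (U : set 'rV[R]_m)
    (f : 'rV[R]_m -> R) : Prop :=
  forall (s : seq 'I_m) (x : 'rV[R]_m), U x -> differentiable (iter_partial s f) x.

(* A smooth manifold modelled on R^m, given by a topological space and a smooth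
   atlas.  The chart c is the homeomorphism [coord c] from the open set [dom c]
   onto an open subset of R^m, with inverse [param c]; both are total functions,
   arbitrary outside of these sets. *)
Record manifold (R : realType) (m : nat) := Manifold {
  point :> topologicalType;
  chart : Type;
  dom : chart -> set point;
  coord : chart -> point -> 'rV[R]_m;
  param : chart -> 'rV[R]_m -> point;
  manifold_hausdorff : hausdorff_space point;
  manifold_second_countable : @second_countable point;
  dom_cover : \bigcup_c dom c = [set: point];
  dom_open : forall c, open (dom c);
  img_open : forall c, open (coord c @` dom c);
  coordK : forall c p, dom c p -> param c (coord c p) = p;
  coord_continuous : forall c, {within dom c, continuous (coord c)};
  param_continuous :
    forall c, {within coord c @` dom c, continuous (param c)};
  transition_smooth : forall c d k,
    smooth_on (coord c @` (dom c `&` dom d))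
      (fun x => coord d (param c x) 0 k)
}.

Section LocalCalculus.
Variables (R : realType) (m : nat) (M : manifold R m).
Implicit Types (c d : chart M) (p : M).

Definition smooth_in c (f : M -> R) : Prop :=
  smooth_on (coord c @` dom c) (f \o param c).

(* d f / d x^k at p, x being the coordinates of the chart c *)
Definition partial c (k : 'I_m) (f : M -> R) p : R :=
  'D_(delta_mx 0 k) (f \o param c) (coord c p).

(* d y^k / d x^l, x and y being the coordinates of c and d *)
Definition jacobian c d p : 'M[R]_m :=
  \matrix_(k, l) partial c l (fun q => coord d q 0 k) p.

(* Tensor fields are given by their components in every chart, subject to the
   transformation laws below.  Tangent vectors at p are column vectors and
   covectors are row vectors; an endomorphism A acts by v |-> A v and a bilinear
   form B by (u, v) |-> u^T B v.  Components in c matter only on [dom c]. *)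
Definition vector_family := chart M -> M -> 'cV[R]_m.
Definition covector_family := chart M -> M -> 'rV[R]_m.
Definition matrix_family := chart M -> M -> 'M[R]_m.

Definition is_vector_field (X : vector_family) : Prop :=
  (forall c i, smooth_in c (fun p => X c p i 0)) /\
  (forall c d p, dom c p -> dom d p -> X d p = jacobian c d p *m X c p).

Definition is_one_form (theta : covector_family) : Prop :=
  (forall c j, smooth_in c (fun p => theta c p 0 j)) /\
  (forall c d p, dom c p -> dom d p ->
     theta c p = theta d p *m jacobian c d p).

Definition is_endomorphism_field (A : matrix_family) : Prop :=
  (forall c i j, smooth_in c (fun p => A c p i j)) /\
  (forall c d p, dom c p -> dom d p ->
     A d p *m jacobian c d p = jacobian c d p *m A c p).

Definition is_bilinear_field (B : matrix_family) : Prop :=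
  (forall c i j, smooth_in c (fun p => B c p i j)) /\
  (forall c d p, dom c p -> dom d p ->
     B c p = (jacobian c d p)^T *m B d p *m jacobian c d p).

Definition pairing (theta : 'rV[R]_m) (v : 'cV[R]_m) : R := (theta *m v) 0 0.

Definition bilin (B : 'M[R]_m) (u v : 'cV[R]_m) : R := (u^T *m B *m v) 0 0.

Definition tensor_prod (theta omega : 'rV[R]_m) : 'M[R]_m := theta^T *m omega.

Definition sym_prod (theta omega : 'rV[R]_m) : 'M[R]_m :=
  2^-1 *: (tensor_prod theta omega + tensor_prod omega theta).

Definition is_riemannian_metric (g : matrix_family) : Prop :=
  [/\ is_bilinear_field g,
      (forall c p, dom c p -> forall u v, bilin (g c p) u v = bilin (g c p) v u) &
      (forall c p, dom c p -> forall v, v != 0 -> 0 < bilin (g c p) v v)].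

(* In the rest of this section X, Y, Z : M -> 'cV[R]_m are the components of
   vector fields on the domain of the chart c. *)

Definition smooth_local c (X : M -> 'cV[R]_m) : Prop :=
  forall i, smooth_in c (fun p => X p i 0).

Definition coord_field (k : 'I_m) : M -> 'cV[R]_m := fun _ => delta_mx k 0.

Definition dirder c (X : M -> 'cV[R]_m) (f : M -> R) p : R :=
  \sum_k X p k 0 * partial c k f p.

Definition bracket c (X Y : M -> 'cV[R]_m) p : 'cV[R]_m :=
  \col_i (dirder c X (fun q => Y q i 0) p - dirder c Y (fun q => X q i 0) p).

Definition christoffel (g : matrix_family) c (i j k : 'I_m) p : R :=
  2^-1 * \sum_l invmx (g c p) i l *
    (partial c j (fun q => g c q k l) p + partial c k (fun q => g c q j l) p
     - partial c l (fun q => g c q j k) p).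

(* the Levi-Civita connection of g *)
Definition nabla (g : matrix_family) c (X Y : M -> 'cV[R]_m) p : 'cV[R]_m :=
  \col_i (dirder c X (fun q => Y q i 0) p
          + \sum_j \sum_k christoffel g c i j k p * X p j 0 * Y p k 0).

Definition curvature (g : matrix_family) c (X Y Z : M -> 'cV[R]_m) p :
    'cV[R]_m :=
  nabla g c X (nabla g c Y Z) p - nabla g c Y (nabla g c X Z) p
  - nabla g c (bracket c X Y) Z p.

(* Ric(Y, Z) is the trace of X |-> R(X, Y) Z. *)
Definition ricci (g : matrix_family) : matrix_family := fun c p =>
  \matrix_(i, j) \sum_k
    curvature g c (coord_field k) (coord_field i) (coord_field j) p k 0.

(* (L_X theta)(Y) = X (theta (Y)) - theta ([X, Y]) *)
Definition lie_form (X : vector_family) (theta : covector_family) :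
    covector_family := fun c p =>
  \row_j (dirder c (X c) (fun q => pairing (theta c q) (coord_field j q)) p
          - pairing (theta c p) (bracket c (X c) (coord_field j) p)).

(* (L_X B)(Y, Z) = X (B (Y, Z)) - B ([X, Y], Z) - B (Y, [X, Z]) *)
Definition lie_bilin (X : vector_family) (B : matrix_family) :
    matrix_family := fun c p =>
  \matrix_(i, j)
    (dirder c (X c)
       (fun q => bilin (B c q) (coord_field i q) (coord_field j q)) p
     - bilin (B c p) (bracket c (X c) (coord_field i) p) (coord_field j p)
     - bilin (B c p) (coord_field i p) (bracket c (X c) (coord_field j) p)).

End LocalCalculus.

Record contact_data (R : realType) (m : nat) (M : manifold R m) := ContactData {
  phi : matrix_family M;
  xi : vector_family M;
  eta : covector_family M;
  metric : matrix_family M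
}.

Definition almost_contact_metric (R : realType) (m : nat) (M : manifold R m)
    (S : contact_data M) : Prop :=
  [/\ is_endomorphism_field (phi S), is_vector_field (xi S),
      is_one_form (eta S), is_riemannian_metric (metric S) &
      forall (c : chart M) (p : M), dom c p ->
      [/\ (forall X : 'cV[R]_m, phi S c p *m (phi S c p *m X)
             = - X + pairing (eta S c p) X *: xi S c p),
          pairing (eta S c p) (xi S c p) = 1 &
          (forall X Y : 'cV[R]_m,
             bilin (metric S c p) (phi S c p *m X) (phi S c p *m Y)
             = bilin (metric S c p) X Y
               - pairing (eta S c p) X * pairing (eta S c p) Y)]].

(* (nabla_X phi) Y = nabla_X (phi Y) - phi (nabla_X Y), tested on all local
   vector fields X, Y on chart domains. *)
Definition alpha_sasakian (R : realType) (m : nat) (M : manifold R m)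
    (alpha : R) (S : contact_data M) : Prop :=
  [/\ almost_contact_metric S, alpha != 0 &
      forall (c : chart M) (X Y : M -> 'cV[R]_m),
      smooth_local c X -> smooth_local c Y ->
      forall p : M, dom c p ->
      nabla (metric S) c X (fun q => phi S c q *m Y q) p
      - phi S c p *m nabla (metric S) c X Y p
      = alpha *: (bilin (metric S c p) (X p) (Y p) *: xi S c p
                  - pairing (eta S c p) (Y p) *: X p)].

Definition twisted_eta_ricci_soliton (R : realType) (m : nat)
    (M : manifold R m) (S : contact_data M) : Prop :=
  exists (X : vector_family M) (lambda C1 C2 : R),
    is_vector_field X /\
    forall (c : chart M) (p : M), dom c p ->
      ricci (metric S) c p + 2^-1 *: lie_bilin X (metric S) c p
        = lambda *: metric S c p
          + (2 * C1) *: sym_prod (lie_form X (eta S) c p) (eta S c p)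
          + C2 *: tensor_prod (eta S c p) (eta S c p)
      /\ pairing (eta S c p) (X c p) = 0.

Definition D_homothety (R : realType) (m : nat) (M : manifold R m) (a b : R)
    (S : contact_data M) : contact_data M := {|
  phi := phi S;
  xi := fun c p => b^-1 *: xi S c p;
  eta := fun c p => b *: eta S c p;
  metric := fun c p => a *: metric S c p
    + (b ^+ 2 - a) *: tensor_prod (eta S c p) (eta S c p)
|}.

(* Main.v *)
(* The connection of g' = a g + (b^2 - a) eta (x) eta is nabla + A with
   A(Y, Z) = kappa (eta(Y) phi Z + eta(Z) phi Y), kappa = - alpha (b^2 - a) / a:
   this connection is torsion-free, and it preserves g' because
   (nabla_Y eta)(Z) = alpha g(Y, phi Z).  Substituting A in the curvature and
   using the formula for nabla phi, tr phi = 0 and tr phi^2 = 1 - m, where m is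
   the dimension, gives Ric' = Ric + r g + s eta (x) eta with constants r, s.
   Since L_X g' = a L_X g + 2 (b^2 - a) (L_X eta) (.) eta, the vector field
   X' = X / a solves the soliton equation of g' with adjusted constants. *)

From Pilot Require Import Defs.
From HB Require Import structures.
From mathcomp Require Import all_boot all_order all_algebra.
From mathcomp Require Import all_classical all_reals all_analysis.
From mathcomp Require Import ring.
(* Restores [coord], which vector shadows. *)
Import Pilot.Defs.

Set Implicit Arguments.
Unset Strict Implicit.
Unset Printing Implicit Defensive.

Import Order.TTheory GRing.Theory Num.Theory.
Import numFieldNormedType.Exports.

Local Open Scope classical_set_scope.
Local Open Scope ring_scope.

(** * Calculus in a chart *)

Section Derivatives.
Variables (R : realType) (V : normedModType R).

(** The difference [h - f] vanishes near [x], so it is little-o of the increment and has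
    differential zero; then [h] is [f] plus a differentiable function. *)
Lemma near_eq_differentiable (f h : V -> R) (x : V) :
  (\forall y \near x, f y = h y) -> differentiable f x -> differentiable h x.
Proof.
move=> fh df.
have hz : (h - f) \o shift x = cst ((h - f) x) + (0 : V -> R) +o_ 0 id.
  apply/eqaddoP => _/posnumP[e].
  have : \forall y \near (0 : V), f (y + x) = h (y + x).
    by move: fh; rewrite (near_shift 0 x) /= subr0.
  apply: filterS => y /= fhy.
  have fhx : f x = h x by exact: (nbhs_singleton fh).
  rewrite /cst !fctE /= fhy fhx !subrr addr0 subr0 normr0.
  by apply: mulr_ge0.
have cz : continuous (0 : V -> R) by move=> y; exact: cvg_cst.
have dz := @diff_unique R V R (h - f) (@GRing.null_fun V R) x cz hz.
have dhf : differentiable (h - f) x.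
  by apply/diff_locallyP; rewrite dz.
have -> : h = f + (h - f) by apply/funext => y; rewrite !fctE addrC subrK.
exact: differentiableD.
Qed.

Lemma is_derive_bigsum (I : Type) (r : seq I) (P : pred I) (h : I -> V -> R)
    (dh : I -> R) (x v : V) :
  (forall i, is_derive x v (h i) (dh i)) ->
  is_derive x v (fun y => \sum_(i <- r | P i) h i y) (\sum_(i <- r | P i) dh i).
Proof.
move=> hd; elim: r => [|i r IH].
  rewrite big_nil; under eq_fun do rewrite big_nil; exact: is_derive_cst.
rewrite big_cons; under eq_fun do rewrite big_cons.
by case: (P i) => //; exact: is_deriveD.
Qed.

Lemma derivable_bigsum (I : Type) (r : seq I) (P : pred I) (h : I -> V -> R)
    (x v : V) :
  (forall i, derivable (h i) x v) ->
  derivable (fun y => \sum_(i <- r | P i) h i y) x v.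
Proof.
by move=> hd; have [] := is_derive_bigsum r P (fun i => derivableP (hd i)).
Qed.

Lemma derivable_bigprod (I : Type) (r : seq I) (P : pred I) (h : I -> V -> R)
    (x v : V) :
  (forall i, derivable (h i) x v) ->
  derivable (fun y => \prod_(i <- r | P i) h i y) x v.
Proof.
move=> hd; elim: r => [|i r IH].
  under eq_fun do rewrite big_nil; exact: derivable_cst.
under eq_fun do rewrite big_cons.
case: (P i) => //.
by apply: (@derivableM _ _ (h i) (fun y => \prod_(j <- r | P j) h j y)).
Qed.

Lemma derivable_det (m : nat) (F : V -> 'M[R]_m) (x v : V) :
  (forall i j, derivable (fun y => F y i j) x v) ->
  derivable (fun y => \det (F y)) x v.
Proof.
move=> dF; rewrite /determinant.
apply: derivable_bigsum => s; apply: derivableM; first exact: derivable_cst.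
exact: derivable_bigprod.
Qed.

(** Cramer's rule: near [x] the entries of the inverse are cofactors divided by the determinant.
    Invertibility is asked on a neighbourhood because [invmx] has a default value at singular
    matrices. *)
Lemma derivable_invmx (m : nat) (F : V -> 'M[R]_m) (x v : V) i j :
  (\forall y \near x, F y \in unitmx) ->
  (forall i j, derivable (fun y => F y i j) x v) ->
  derivable (fun y => invmx (F y) i j) x v.
Proof.
move=> uF dF.
apply: (@near_eq_derivable _ _ _
  (fun y => (\det (F y))^-1 * cofactor (F y) j i)).
  by apply: filterS uF => y uFy; rewrite /invmx uFy !mxE.
apply: derivableM.
  apply: derivableV; last exact: derivable_det.
  by have := nbhs_singleton uF; rewrite unitmxE unitfE.
rewrite /cofactor; apply: derivableM; first exact: derivable_cst.
apply: derivable_det => k l.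
by under eq_fun do rewrite !mxE; exact: dF.
Qed.

End Derivatives.

Section ChartCalculus.
Variables (R : realType) (m : nat) (M : manifold R m) (c : chart M).
Implicit Types (p : M) (k : 'I_m).

(** The image of a chart is open. This is what allows identities between fields, known only on
    [dom c], to be differentiated. *)
Lemma near_chart (P : M -> Prop) p : dom c p -> (forall q, dom c q -> P q) ->
  \forall x \near coord c p, P (param c x).
Proof.
move=> cp HP; have : nbhs (coord c p) (coord c @` dom c).
  by apply: open_nbhs_nbhs; split; [exact: img_open|exists p].
by apply: filterS => _ [q cq <-]; rewrite coordK //; exact: HP.
Qed.

Lemma coordK_comp (f : M -> R) p : dom c p ->
  (f \o param c) (coord c p) = f p.
Proof. by move=> cp; rewrite /= coordK. Qed.

Definition partial_mx k r s (F : M -> 'M[R]_(r, s)) p : 'M[R]_(r, s) :=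
  \matrix_(i, j) partial c k (fun q => F q i j) p.

(** Being relational, this records derivability together with the value, so the sum and product
    rules chain without separate side conditions. *)
Definition has_partial_mx k r s (F : M -> 'M[R]_(r, s)) p (D : 'M[R]_(r, s)) :=
  forall i j, is_derive (coord c p) (delta_mx 0 k : 'rV[R]_m)
                ((fun q => F q i j) \o param c) (D i j).

Lemma has_partial_mxE k r s (F : M -> 'M[R]_(r, s)) p D :
  has_partial_mx k F p D -> partial_mx k F p = D.
Proof.
by move=> FD; apply/matrixP => i j; rewrite mxE; case: (FD i j).
Qed.

Lemma has_partial_mxP k r s (F : M -> 'M[R]_(r, s)) p :
  (forall i j, derivable ((fun q => F q i j) \o param c) (coord c p)
                 (delta_mx 0 k : 'rV[R]_m)) ->
  has_partial_mx k F p (partial_mx k F p).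
Proof. by move=> dF i j; rewrite mxE; exact: derivableP. Qed.

Lemma has_partial_mx_eq k r s (F G : M -> 'M[R]_(r, s)) p D : dom c p ->
  (forall q, dom c q -> F q = G q) ->
  has_partial_mx k F p D -> has_partial_mx k G p D.
Proof.
move=> cp FG FD i j; apply: near_eq_is_derive (FD i j).
by apply: (near_chart cp (P := fun q => F q i j = G q i j)) => q /FG ->.
Qed.

Lemma partial_eq k (f h : M -> R) p : dom c p ->
  (forall q, dom c q -> f q = h q) -> partial c k f p = partial c k h p.
Proof.
move=> cp fh; apply: near_eq_derive.
exact: (near_chart cp (P := fun q => f q = h q)).
Qed.

Lemma has_partial_mx_cst k r s (A : 'M[R]_(r, s)) p :
  has_partial_mx k (fun=> A) p 0.
Proof. by move=> i j; rewrite mxE; exact: is_derive_cst. Qed.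

Lemma has_partial_mxD k r s (F G : M -> 'M[R]_(r, s)) p D E :
  has_partial_mx k F p D -> has_partial_mx k G p E ->
  has_partial_mx k (fun q => F q + G q) p (D + E).
Proof.
move=> FD GE i j; rewrite mxE.
have -> : (fun q => (F q + G q) i j) \o param c =
  ((fun q => F q i j) \o param c) + ((fun q => G q i j) \o param c).
  by apply/funext => x; rewrite /= mxE.
exact: is_deriveD.
Qed.

Lemma has_partial_mxZ k r s a (F : M -> 'M[R]_(r, s)) p D :
  has_partial_mx k F p D -> has_partial_mx k (fun q => a *: F q) p (a *: D).
Proof.
move=> FD i j; rewrite mxE.
have -> : (fun q => (a *: F q) i j) \o param c =
  a \*: ((fun q => F q i j) \o param c).
  by apply/funext => x; rewrite /= mxE.
exact: is_deriveZ.
Qed.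

Lemma has_partial_mxM k r s t (F : M -> 'M[R]_(r, s)) (G : M -> 'M[R]_(s, t)) p
    D E : dom c p ->
  has_partial_mx k F p D -> has_partial_mx k G p E ->
  has_partial_mx k (fun q => F q *m G q) p (D *m G p + F p *m E).
Proof.
move=> cp FD GE i j.
have -> : (fun q => (F q *m G q) i j) \o param c =
  fun x => \sum_l (F (param c x) i l * G (param c x) l j).
  by apply/funext => x; rewrite /= mxE.
rewrite !mxE -big_split /=; apply: is_derive_bigsum => l.
have H := is_deriveM (FD i l) (GE l j); apply: (is_derive_eq H).
rewrite !coordK_comp // addrC; congr (_ + _); exact: mulrC.
Qed.

Lemma has_partial_mx_tr k r s (F : M -> 'M[R]_(r, s)) p D :
  has_partial_mx k F p D -> has_partial_mx k (fun q => (F q)^T) p D^T.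
Proof.
move=> FD i j; rewrite mxE.
have -> : (fun q => (F q)^T i j) = (fun q => F q j i).
  by apply/funext => q; rewrite mxE.
exact: FD.
Qed.

Lemma smooth_in_derivable (f : M -> R) k p : dom c p -> smooth_in c f ->
  derivable (f \o param c) (coord c p) (delta_mx 0 k : 'rV[R]_m).
Proof.
move=> cp sf; apply: diff_derivable; apply: (sf [::]); by exists p.
Qed.

(** In coordinates, [partial c k f] agrees with the directional derivative of [f \o param c] only on
    the image of the chart, where [coord c] inverts [param c]; openness of the image makes this
    enough. *)
Lemma smooth_in_partial (f : M -> R) k l p : dom c p -> smooth_in c f ->
  derivable (partial c k f \o param c) (coord c p) (delta_mx 0 l : 'rV[R]_m).
Proof.
move=> cp sf.
apply: (@near_eq_derivable _ _ _
  (fun x => 'D_(delta_mx 0 k : 'rV[R]_m) (f \o param c) x)).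
  have : nbhs (coord c p) (coord c @` dom c).
    by apply: open_nbhs_nbhs; split; [exact: img_open|exists p].
  by apply: filterS => _ [q cq <-]; rewrite /= /partial coordK.
apply: diff_derivable; apply: (sf [:: k]); by exists p.
Qed.

Lemma smooth_in_mx k r s (F : M -> 'M[R]_(r, s)) p : dom c p ->
  (forall i j, smooth_in c (fun q => F q i j)) ->
  has_partial_mx k F p (partial_mx k F p).
Proof.
by move=> cp sF; apply: has_partial_mxP => i j; exact: smooth_in_derivable.
Qed.

Lemma iter_partialZ (a : R) (f : M -> R) s p : dom c p -> smooth_in c f ->
  \forall x \near coord c p,
    iter_partial s (a \*: (f \o param c)) x
    = a * iter_partial s (f \o param c) x.
Proof.
move=> cp sf.
have U q : dom c q -> nbhs (coord c q) (coord c @` dom c).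
  by move=> cq; apply: open_nbhs_nbhs; split; [exact: img_open|exists q].
(* The equality is proved on the whole open image, since the induction step differentiates it and so
   needs it on a neighbourhood. *)
suff H : forall x, (coord c @` dom c) x ->
    iter_partial s (a \*: (f \o param c)) x
    = a * iter_partial s (f \o param c) x.
  exact: filterS (U p cp).
elim: s => [//|j s IH] _ [q cq <-] /=.
rewrite (@near_eq_derive _ _ _ _ (a \*: iter_partial s (f \o param c))).
  by rewrite deriveZ //; apply: diff_derivable; apply: (sf s); exists q.
by apply: filterS (U q cq) => x /IH ->.
Qed.

Lemma smooth_inZ (a : R) (f : M -> R) : smooth_in c f ->
  smooth_in c (fun q => a * f q).
Proof.
move=> sf s _ [p cp <-].
apply: (@near_eq_differentiable _ _ (a \*: iter_partial s (f \o param c))).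
  by apply: filterS (iter_partialZ a s cp sf) => x ->.
by apply: differentiableZ; apply: (sf s); exists p.
Qed.

Lemma smooth_in_cst (a : R) : smooth_in c (fun=> a).
Proof.
move=> s x _; suff [b ->] : exists b : R,
    iter_partial s ((fun=> a) \o param c) = cst b by exact: differentiable_cst.
elim: s => [|j s [b IH]]; first by exists a.
by exists 0; apply/funext => y /=; rewrite IH derive_cst.
Qed.

End ChartCalculus.

(** * Levi-Civita connection and Ricci tensor in a chart *)

Section Connection.
Variables (R : realType) (m : nat) (M : manifold R m) (c : chart M).
Variable g : matrix_family M.
Implicit Types (p : M) (k : 'I_m).

(* nabla_(d_k) acts on component columns as d_k + connection_mx k. *)
Definition connection_mx k p : 'M[R]_m :=
  \matrix_(i, j) christoffel g c i k j p.

(** Christoffel symbols of the first kind; the row [l] is the lowered index. *)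
Definition lowered_christoffel k p : 'M[R]_m :=
  \matrix_(l, j) (2^-1 * (partial c k (fun q => g c q j l) p
    + partial c j (fun q => g c q k l) p - partial c l (fun q => g c q k j) p)).

Lemma connection_mxE k p :
  connection_mx k p = invmx (g c p) *m lowered_christoffel k p.
Proof.
apply/matrixP => i j; rewrite !mxE /christoffel mulr_sumr.
by apply: eq_bigr => l _; rewrite mxE mulrCA.
Qed.

Section SymmetricMetric.
Hypothesis gT : forall q, dom c q -> (g c q)^T = g c q.

Lemma partial_metricC k i j p : dom c p ->
  partial c k (fun q => g c q i j) p = partial c k (fun q => g c q j i) p.
Proof.
move=> cp; apply: partial_eq => // q cq.
by rewrite -[in LHS](gT cq) mxE.
Qed.

(** Vanishing of the torsion. *)
Lemma connection_mxC k i j p : dom c p ->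
  connection_mx k p i j = connection_mx j p i k.
Proof.
move=> cp; rewrite !connection_mxE !mxE; apply: eq_bigr => l _; rewrite !mxE.
by rewrite (partial_metricC l j k cp) [X in X - _]addrC.
Qed.

(** This is [nabla g = 0]: in the sum of [lowered_christoffel k p] and its transpose the last two
    derivatives cancel and [d_k g] remains. *)
Lemma metric_compatible k p : dom c p -> g c p \in unitmx ->
  partial_mx c k (g c) p
  = (connection_mx k p)^T *m g c p + g c p *m connection_mx k p.
Proof.
move=> cp gu; rewrite -{1}(gT cp) -trmx_mul connection_mxE mulKVmx //.
apply/matrixP => i j; rewrite !mxE.
by rewrite (partial_metricC k j i cp); field.
Qed.

(** Koszul's argument. Compatibility expresses the derivatives of [g] through [S j = g C_j], and
    symmetry of [C] collapses the alternating combination of three derivatives to twice [S k]. *)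
Lemma connection_mx_unique (C : 'I_m -> 'M[R]_m) p :
  dom c p -> g c p \in unitmx -> (forall k i j, C k i j = C j i k) ->
  (forall k, partial_mx c k (g c) p = (C k)^T *m g c p + g c p *m C k) ->
  forall k, connection_mx k p = C k.
Proof.
move=> cp gu CC Cg k; apply: (can_inj (mulKmx gu)).
rewrite connection_mxE mulKVmx //.
pose S j := g c p *m C j.
have SC j l i : S j l i = S i l j.
  by rewrite !mxE; apply: eq_bigr => r _; rewrite CC.
have dg l i j : partial c l (fun q => g c q i j) p = S l j i + S l i j.
  have /matrixP/(_ i j) := Cg l; rewrite mxE => ->.
  by rewrite -{1}(gT cp) -trmx_mul !mxE.
apply/matrixP => l j; rewrite mxE !dg (SC j l k) (SC j k l) (SC l j k) -/(S k).
by field.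
Qed.

End SymmetricMetric.

Lemma partial_cst k (a : R) p : partial c k (fun=> a) p = 0.
Proof. exact: derive_cst. Qed.

Lemma dirder_coord_field k (f : M -> R) p :
  dirder c (coord_field k) f p = partial c k f p.
Proof.
rewrite /dirder (bigD1 k) //= big1 => [|l lk]; rewrite /coord_field mxE.
  by rewrite !eqxx mul1r addr0.
by rewrite (negbTE lk) mul0r.
Qed.

Lemma nabla_coord k (Y : M -> 'cV[R]_m) p :
  nabla g c (coord_field k) Y p
  = partial_mx c k Y p + connection_mx k p *m Y p.
Proof.
apply/matrixP => i j; rewrite !mxE dirder_coord_field ord1; congr (_ + _).
rewrite (bigD1 k) //= [X in _ + X]big1 => [|l lk].
  rewrite addr0; apply: eq_bigr => l _.
  by rewrite /coord_field !mxE !eqxx mulr1.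
by apply: big1 => n _; rewrite /coord_field mxE (negbTE lk) mulr0 mul0r.
Qed.

Lemma partial_coord_field k l p : partial_mx c k (coord_field l) p = 0.
Proof.
by apply/matrixP => i j; rewrite [LHS]mxE [RHS]mxE; exact: partial_cst.
Qed.

Lemma nabla_coord_coord k l p :
  nabla g c (coord_field k) (coord_field l) p = col l (connection_mx k p).
Proof. by rewrite nabla_coord partial_coord_field add0r colE. Qed.

Lemma bracket_coord k l p :
  bracket c (coord_field k) (coord_field l) p = 0 :> 'cV[R]_m.
Proof.
apply/matrixP => i j; rewrite [LHS]mxE [RHS]mxE !dirder_coord_field.
by rewrite /coord_field !partial_cst subrr.
Qed.

Lemma nabla0 (X Y : M -> 'cV[R]_m) p : X p = 0 -> nabla g c X Y p = 0.
Proof.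
move=> X0; apply/matrixP => i j; rewrite !mxE /dirder X0.
rewrite big1 => [|l _]; last by rewrite mxE mul0r.
rewrite add0r big1 // => l _; rewrite big1 // => k _.
by rewrite mxE mulr0 mul0r.
Qed.

Lemma nabla_coord2 k i j p :
  nabla g c (coord_field k) (nabla g c (coord_field i) (coord_field j)) p
  = col j (partial_mx c k (connection_mx i) p
           + connection_mx k p *m connection_mx i p).
Proof.
have -> : nabla g c (coord_field i) (coord_field j)
  = fun q => col j (connection_mx i q).
  by apply/funext => q; rewrite nabla_coord_coord.
rewrite nabla_coord raddfD /= (colE j (connection_mx i p)) mulmxA -colE.
congr (_ + _).
apply/matrixP => a b; rewrite !mxE; congr (partial _ _ _ _).
by apply/funext => q; rewrite mxE.
Qed.

(** Coordinate fields commute, so the curvature endomorphism of [d_k] and [d_i] is [d_k G_i - d_i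
    G_k + [G_k, G_i]], where [G] is the connection matrix. *)
Lemma ricciE i j p : ricci g c p i j = \sum_k
  (partial_mx c k (connection_mx i) p - partial_mx c i (connection_mx k) p
   + (connection_mx k p *m connection_mx i p
      - connection_mx i p *m connection_mx k p)) k j.
Proof.
rewrite mxE; apply: eq_bigr => k _.
rewrite /curvature !nabla_coord2 nabla0; last exact: bracket_coord.
rewrite subr0 -raddfB /= mxE; congr (fun_of_matrix _ k j).
by rewrite opprD addrACA.
Qed.

(** The connection matrix is the inverse metric times first derivatives of the metric, and both
    factors are derivable. *)
Lemma connection_mx_has_partial k p : dom c p ->
  (forall i j, smooth_in c (fun q => g c q i j)) ->
  (forall q, dom c q -> g c q \in unitmx) ->
  forall l, has_partial_mx c l (connection_mx k) p
              (partial_mx c l (connection_mx k) p).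
Proof.
move=> cp sg gu l.
have Hi : has_partial_mx c l (fun q => invmx (g c q)) p
    (partial_mx c l (fun q => invmx (g c q)) p).
  apply: has_partial_mxP => i j.
  apply: (derivable_invmx (F := fun x => g c (param c x))).
    exact: (near_chart cp (P := fun q => g c q \in unitmx)).
  by move=> a b; exact: (@smooth_in_derivable _ _ _ _ _ l _ cp (sg a b)).
have Hl : has_partial_mx c l (lowered_christoffel k) p
    (partial_mx c l (lowered_christoffel k) p).
  apply: has_partial_mxP => i j.
  have -> : (fun q => lowered_christoffel k q i j) \o param c =
    2^-1 \*: ((partial c k (fun q => g c q j i) \o param c)
      + (partial c j (fun q => g c q k i) \o param c)
      - (partial c i (fun q => g c q k j) \o param c)).
    by apply/funext => x; rewrite /= mxE.
  apply: derivableZ; apply: derivableB; first apply: derivableD;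
    exact: smooth_in_partial.
rewrite (_ : connection_mx k =
  fun q => invmx (g c q) *m lowered_christoffel k q); last first.
  by apply/funext => q; exact: connection_mxE.
by have HM := has_partial_mxM cp Hi Hl; rewrite (has_partial_mxE HM).
Qed.

End Connection.

(** * Almost contact and alpha-Sasakian structures *)

Lemma mulmx_delta (R : pzRingType) m n (A B : 'M[R]_(m, n)) :
  (forall j, A *m (delta_mx j 0 : 'cV_n) = B *m delta_mx j 0) -> A = B.
Proof.
move=> AB; apply/matrixP => i j.
by have /matrixP/(_ i 0) := AB j; rewrite -!colE !mxE.
Qed.

Lemma bilin_delta (R : realType) m (A : 'M[R]_m) i j :
  bilin A (delta_mx i 0) (delta_mx j 0) = A i j.
Proof. by rewrite /bilin trmx_delta -rowE -colE !mxE. Qed.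

Lemma pairing_delta (R : realType) m (A : 'rV[R]_m) j :
  pairing A (delta_mx j 0) = A 0 j.
Proof. by rewrite /pairing -colE mxE. Qed.

(** A non-zero kernel vector would be isotropic. *)
Lemma posdef_unitmx (R : realType) m (A : 'M[R]_m) : A^T = A ->
  (forall v : 'cV[R]_m, v != 0 -> 0 < bilin A v v) -> A \in unitmx.
Proof.
move=> AT Apos; rewrite -row_free_unit -kermx_eq0; apply/rowV0P => v.
move/sub_kermxP => vA; apply/eqP; apply: contraT => v0.
have /Apos : v^T != 0.
  by apply: contra_neq v0 => vT0; rewrite -[v]trmxK vT0 trmx0.
by rewrite /bilin trmxK vA mul0mx mxE ltxx.
Qed.

Section AlmostContact.
Variables (R : realType) (m : nat) (M : manifold R m) (S : contact_data M).
Hypothesis hS : almost_contact_metric S.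
Variables (c : chart M) (p : M).
Hypothesis cp : dom c p.

Local Notation F := (phi S c p).
Local Notation x := (xi S c p).
Local Notation e := (eta S c p).
Local Notation g := (metric S c p).

Lemma metric_sym : g^T = g.
Proof.
have [_ _ _ [_ gsym _] _] := hS; apply/matrixP => i j.
have := gsym c p cp (delta_mx i 0) (delta_mx j 0).
by rewrite !bilin_delta mxE => ->.
Qed.

Lemma metric_unit : g \in unitmx.
Proof.
have [_ _ _ [_ _ gpos] _] := hS.
exact: posdef_unitmx metric_sym (gpos c p cp).
Qed.

Lemma phi_sqr : F *m F = - 1%:M + x *m e.
Proof.
have [_ _ _ _ /(_ c p cp)[ff _ _]] := hS; apply: mulmx_delta => j.
rewrite -mulmxA ff mulmxDl mulNmx mul1mx -mulmxA; congr (_ + _).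
by rewrite [e *m _]mx11_scalar mul_mx_scalar.
Qed.

Lemma eta_xi : e *m x = 1%:M.
Proof.
have [_ _ _ _ /(_ c p cp)[_ ex _]] := hS.
by rewrite [e *m x]mx11_scalar -[X in X%:M]/(pairing e x) ex.
Qed.

(** First [phi^2 xi = 0]. Applying the formula for [phi^2] to [phi xi] then gives [phi xi = s xi]
    with [s = eta(phi xi)], whence [s (phi xi) = phi^2 xi = 0]; either factor being zero yields the
    claim. *)
Lemma phi_xi : F *m x = 0.
Proof.
have ffx : F *m F *m x = 0.
  by rewrite phi_sqr mulmxDl mulNmx mul1mx -mulmxA eta_xi mulmx1 addNr.
have fx : F *m x = x *m (e *m (F *m x)).
  have : F *m F *m (F *m x) = 0.
    by rewrite -[LHS]mulmxA (mulmxA F F x) ffx mulmx0.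
  rewrite {1}phi_sqr mulmxDl mulNmx mul1mx -mulmxA => /eqP.
  by rewrite addrC subr_eq0 => /eqP.
have [s ef] : exists s : R, e *m (F *m x) = s%:M.
  by exists ((e *m (F *m x)) 0 0); exact: mx11_scalar.
rewrite ef mul_mx_scalar in fx.
have : s *: (F *m x) = 0 by rewrite scalemxAr -fx mulmxA ffx.
move/eqP; rewrite scaler_eq0 => /orP[/eqP s0|/eqP //].
by rewrite fx s0 scale0r.
Qed.

(** Expanding [phi^3] as [phi^2 phi] and as [phi phi^2] leaves [xi (eta phi) = (phi xi) eta = 0];
    [eta] applied on the left removes [xi]. *)
Lemma eta_phi : e *m F = 0.
Proof.
have /eqP : F *m F *m F = F *m (F *m F) by rewrite mulmxA.
rewrite phi_sqr mulmxDl mulmxDr mulNmx mulmxN mul1mx mulmx1 mulmxA phi_xi.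
rewrite mul0mx (inj_eq (addrI _)) -mulmxA => /eqP H.
by rewrite -(mul1mx (e *m F)) -eta_xi -mulmxA H mulmx0.
Qed.

Lemma metric_phi_phi : F^T *m g *m F = g - e^T *m e.
Proof.
have [_ _ _ _ /(_ c p cp)[_ _ comp]] := hS; apply/matrixP => i j.
have := comp (delta_mx i 0) (delta_mx j 0).
rewrite !bilin_delta !pairing_delta.
rewrite (_ : bilin _ _ _ = bilin (F^T *m g *m F) (delta_mx i 0) (delta_mx j 0)).
  by rewrite bilin_delta => ->; rewrite [RHS]mxE [in RHS]mxE !mxE big_ord1 !mxE.
by rewrite /bilin trmx_mul !mulmxA.
Qed.

(** The compatibility of [phi] with the metric, evaluated at [xi], has zero left side. *)
Lemma metric_xi : g *m x = e^T.
Proof.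
have /(congr1 (mulmx^~ x)) := metric_phi_phi.
rewrite -mulmxA phi_xi mulmx0 mulmxBl -mulmxA eta_xi mulmx1 => /esym/eqP.
by rewrite subr_eq0 => /eqP.
Qed.

Lemma xi_metric : x^T *m g = e.
Proof. by rewrite -[e]trmxK -metric_xi trmx_mul metric_sym. Qed.

(** Compose the compatibility of [phi] with the metric with [phi] on the right; [eta phi = 0]
    removes both terms in [eta]. *)
Lemma metric_phi_skew : F^T *m g = - (g *m F).
Proof.
have /(congr1 (mulmx^~ F)) := metric_phi_phi.
rewrite -[LHS]mulmxA phi_sqr mulmxDr mulmxN mulmx1 mulmxBl -[in RHS]mulmxA.
rewrite eta_phi mulmx0 subr0 -!mulmxA (mulmxA g) metric_xi mulmxA -trmx_mul.
by rewrite eta_phi trmx0 mul0mx addr0 => <-; rewrite opprK.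
Qed.

(** Skewness makes the transpose of [phi] conjugate to [- phi] through the metric, so the trace
    equals its own opposite. *)
Lemma tr_phi : \tr F = 0.
Proof.
have h : \tr F = - \tr F.
  rewrite -{1}mxtrace_tr -(mulmxK metric_unit F^T) metric_phi_skew.
  rewrite mulNmx linearN /= mxtrace_mulC mulmxA mulVmx ?metric_unit //.
  by rewrite mul1mx.
have /eqP : \tr F *+ 2 = 0 by rewrite mulr2n {1}h addNr.
by rewrite mulrn_eq0 => /eqP.
Qed.

Lemma tr_phi_sqr : \tr (F *m F) = 1 - m%:R.
Proof.
rewrite phi_sqr linearD linearN /= mxtrace1 mxtrace_mulC eta_xi mxtrace1.
by rewrite addrC.
Qed.

End AlmostContact.

Section Entries.
Variables (R : pzRingType) (m n : nat).
Implicit Types (A B : 'M[R]_(m, n)).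

(** With the two lemmas that follow, this opens linear combinations but keeps matrix products closed
    as atoms for [ring]; [mxE] would unfold them too. *)
Lemma mxDE A B i j : (A + B) i j = A i j + B i j.
Proof. by rewrite mxE. Qed.

Lemma mxNE A i j : (- A) i j = - A i j.
Proof. by rewrite mxE. Qed.

Lemma mxZE a A i j : (a *: A) i j = a * A i j.
Proof. by rewrite mxE. Qed.

End Entries.

Lemma has_partial_mxS (R : realType) m (M : manifold R m) (c : chart M) k r s
    (f : M -> R) (F : M -> 'M[R]_(r, s)) p d D : dom c p ->
  is_derive (coord c p) (delta_mx 0 k : 'rV[R]_m) (f \o param c) d ->
  has_partial_mx c k F p D ->
  has_partial_mx c k (fun q => f q *: F q) p (d *: F p + f p *: D).
Proof.
move=> cp fd FD i j.
have -> : (fun q => (f q *: F q) i j) \o param c =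
    (f \o param c) * ((fun q => F q i j) \o param c).
  by apply/funext => x; rewrite /= mxE.
apply: (is_derive_eq (is_deriveM fd (FD i j))).
rewrite !coordK_comp // !mxE addrC; congr (_ + _); exact: mulrC.
Qed.

(** * Covariant derivatives of [phi] and [eta] on an alpha-Sasakian manifold *)

Section Sasakian.
Variables (R : realType) (m : nat) (M : manifold R m) (S : contact_data M).
Variable alpha : R.
Hypothesis hS : alpha_sasakian alpha S.
Variables (c : chart M).

Let acm : almost_contact_metric S.
Proof. by have [] := hS. Qed.

Local Notation F := (phi S c).
Local Notation x := (xi S c).
Local Notation e := (eta S c).
Local Notation g := (metric S c).
Local Notation G := (connection_mx c (metric S)).

Lemma phi_has_partial k p : dom c p ->
  has_partial_mx c k F p (partial_mx c k F p).
Proof. by move=> cp; have [[sF _] _ _ _ _] := acm; exact: smooth_in_mx. Qed.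

Lemma xi_has_partial k p : dom c p ->
  has_partial_mx c k x p (partial_mx c k x p).
Proof.
move=> cp; have [_ [sx _] _ _ _] := acm.
by apply: smooth_in_mx => // i j; rewrite ord1.
Qed.

Lemma eta_has_partial k p : dom c p ->
  has_partial_mx c k e p (partial_mx c k e p).
Proof.
move=> cp; have [_ _ [se _] _ _] := acm.
by apply: smooth_in_mx => // i j; rewrite ord1.
Qed.

Lemma metric_has_partial k p : dom c p ->
  has_partial_mx c k g p (partial_mx c k g p).
Proof.
by move=> cp; have [_ _ _ [[sg _] _ _] _] := acm; exact: smooth_in_mx.
Qed.

(** The endomorphism [nabla_k phi] divided by [alpha]. *)
Definition nabla_phi k p := x p *m row k (g p) - delta_mx k 0 *m e p.

(** The Sasakian identity tested on coordinate fields: their components are constant, so its left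
    side becomes [d_k phi + [G_k, phi]]. *)
Lemma partial_phi k p : dom c p ->
  partial_mx c k F p = F p *m G k p - G k p *m F p + alpha *: nabla_phi k p.
Proof.
move=> cp; have [_ _ nphi] := hS; apply: mulmx_delta => j.
have sc l : smooth_local c (coord_field l : M -> 'cV[R]_m).
  by move=> i; exact: smooth_in_cst.
have := nphi c (coord_field k) (coord_field j) (sc k) (sc j) p cp.
rewrite !nabla_coord /coord_field bilin_delta pairing_delta.
have Fj := has_partial_mxM cp (phi_has_partial k cp)
  (has_partial_mx_cst (M := M) c k (delta_mx j 0 : 'cV[R]_m) p).
rewrite (has_partial_mxE Fj) mulmx0 addr0.
rewrite (has_partial_mxE (has_partial_mx_cst c k (delta_mx j 0 : 'cV_m) p)).
rewrite add0r !mulmxDl mulNmx -scalemxAl => /eqP; rewrite subr_eq => /eqP H.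
rewrite -(addrK (G k p *m (F p *m delta_mx j 0)) (partial_mx _ _ _ _ *m _)) H.
have -> : nabla_phi k p *m (delta_mx j 0 : 'cV_m)
    = g p k j *: x p - e p 0 j *: delta_mx k 0.
  rewrite mulmxBl -!mulmxA -!colE [col j (e p)]mx11_scalar.
  by rewrite [col j (row _ _)]mx11_scalar !mul_mx_scalar !mxE.
by rewrite !mulmxA [RHS]addrC addrA.
Qed.

(** Equivalently [(nabla_k eta)(Z) = alpha g(d_k, phi Z)]. It comes from differentiating
    [phi^2 = - 1 + xi eta] and applying [eta] on the left, once [eta(nabla_k xi) = 0] is known. *)
Lemma partial_eta k p : dom c p ->
  partial_mx c k e p = alpha *: (row k (g p) *m F p) + e p *m G k p.
Proof.
move=> cp; set dF := partial_mx c k F p; set dx := partial_mx c k x p.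
set de := partial_mx c k e p.
have hF := phi_has_partial k cp; have hx := xi_has_partial k cp.
have he := eta_has_partial k cp.
have phi2 := phi_sqr acm cp; have ex := eta_xi acm cp.
have eF := eta_phi acm cp.
have gT := metric_sym acm cp.
have dphi2 : dF *m F p + F p *m dF = dx *m e p + x p *m de.
  have H := has_partial_mxD (has_partial_mx_cst c k (- 1%:M : 'M[R]_m) p)
    (has_partial_mxM cp hx he).
  rewrite add0r in H; rewrite -(has_partial_mxE H).
  apply/esym/has_partial_mxE.
  apply: (has_partial_mx_eq cp _ (has_partial_mxM cp hF hF)) => q cq.
  exact: (phi_sqr acm cq).
have dgx : partial_mx c k g p *m x p + g p *m dx = de^T.
  rewrite -(has_partial_mxE (has_partial_mx_tr he)); apply/esym/has_partial_mxE.
  apply: (has_partial_mx_eq cp _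
    (has_partial_mxM cp (metric_has_partial k cp) hx)).
  by move=> q cq; exact: (metric_xi acm cq).
have dex : de *m x p + e p *m dx = 0.
  rewrite -(has_partial_mxE (has_partial_mx_cst c k (1%:M : 'M[R]_1) p)).
  apply/esym/has_partial_mxE.
  apply: (has_partial_mx_eq cp _ (has_partial_mxM cp he hx)) => q cq.
  exact: (eta_xi acm cq).
(* [Dx] is [nabla_k xi]. Metric duality gives [(nabla_k eta)(xi) = eta(nabla_k xi)], while
   differentiating [eta(xi) = 1] shows that these two numbers add up to zero. *)
pose Dx := dx + G k p *m x p.
have eDx : e p *m Dx = 0.
  have De : de - e p *m G k p = Dx^T *m g p.
    have gT' q : dom c q -> (g q)^T = g q by exact: metric_sym.
    have H : de^T = (e p *m G k p)^T + g p *m Dx.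
      rewrite -dgx (metric_compatible gT' k cp (metric_unit acm cp)) mulmxDl.
      rewrite -mulmxA (metric_xi acm cp) -trmx_mul -addrA -mulmxA -mulmxDr.
      by rewrite [G k p *m _ + _]addrC.
    by rewrite -[de]trmxK H linearD /= trmxK [LHS]addrC addKr trmx_mul gT.
  have h : (de - e p *m G k p) *m x p = e p *m Dx.
    rewrite De -mulmxA (metric_xi acm cp) -trmx_mul.
    by rewrite [e p *m Dx]mx11_scalar tr_scalar_mx.
  have h2 : (de - e p *m G k p) *m x p + e p *m Dx = 0.
    by rewrite mulmxBl mulmxDr mulmxA addrACA dex add0r addNr.
  move: h2; rewrite h -mulr2n => /eqP.
  by rewrite -scaler_nat scaler_eq0 pnatr_eq0 => /eqP.
(* After insertion of [partial_phi], every term containing [eta phi] drops out, and the two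
   occurrences of [eta(d_k xi)] cancel because [eta(Dx) = 0]. *)
have := congr1 (mulmx (e p)) dphi2.
rewrite /dF (partial_phi k cp) /nabla_phi.
rewrite !mulmxDr !mulmxDl !mulmxDr !mulmxA eF !mul0mx.
rewrite mulmxN mulNmx -scalemxAr -scalemxAl mulmxBr mulmxBl !mulmxA ex !mul1mx.
rewrite !addr0 add0r -(mulmxA _ (e p) (F p)) eF mulmx0 subr0.
rewrite -(mulmxA _ (F p) (F p)) phi2 mulmxDr mulmxN mulmx1 mulmxA.
have -> : e p *m G k p *m x p *m e p = - (e p *m dx *m e p).
  apply/eqP; rewrite -addr_eq0 -mulmxDl addrC -[e p *m _ *m x p]mulmxA -mulmxDr.
  by rewrite eDx mul0mx.
rewrite [RHS]addrC => /eqP; rewrite -subr_eq => /eqP <-.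
by rewrite opprD !opprK addrAC addrK addrC.
Qed.

(** * The homothety *)

Section Deformation.
Variables (a b : R).
Hypotheses (a0 : a != 0) (b0 : b != 0).

Definition deformation_coef : R := - (alpha * (b ^+ 2 - a) / a).
Local Notation kappa := deformation_coef.
Local Notation g' := (metric (D_homothety a b S) c).
Local Notation G' := (connection_mx c (metric (D_homothety a b S))).

(** The matrix of [Z |-> A(d_k, Z)], where [A] is the difference of the two connections. *)
Definition deformation k p : 'M[R]_m :=
  kappa *: (e p 0 k *: F p + F p *m (delta_mx k 0 *m e p)).

Lemma deformationE k p i j :
  deformation k p i j = kappa * (e p 0 k * F p i j + F p i k * e p 0 j).
Proof. by rewrite /deformation mulmxA -colE !mxE big_ord1 !mxE. Qed.

Lemma D_metric_sym p : dom c p -> (g' p)^T = g' p.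
Proof.
move=> cp; rewrite /= /tensor_prod linearD !linearZ /= trmx_mul trmxK.
by rewrite (metric_sym acm cp).
Qed.

Lemma D_metric_unit p : dom c p -> g' p \in unitmx.
Proof.
move=> cp; have gu := metric_unit acm cp.
have gx := metric_xi acm cp; have ex := eta_xi acm cp.
have eg : e p *m invmx (g p) = (x p)^T.
  by rewrite -(xi_metric acm cp) -mulmxA mulmxV // mulmx1.
(* The inverse of [g']: the metric is scaled by [a] on the kernel of [eta] and by [b ^+ 2] along
   [xi], so the dual metric is scaled by the inverses of these numbers. *)
pose h := a^-1 *: invmx (g p) + ((b ^+ 2)^-1 - a^-1) *: (x p *m (x p)^T).
suff : g' p *m h = 1%:M by case/mulmx1_unit.
rewrite /= /h /tensor_prod !mulmxDl !mulmxDr -!scalemxAl -!scalemxAr !scalerA.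
rewrite mulmxV // mulmxA gx -!(mulmxA _ (e p)) eg (mulmxA (e p) (x p)) ex.
rewrite mul1mx.
rewrite mulfV // scale1r -addrA -!scalerDl.
rewrite [X in X *: _](_ : _ = 0) ?scale0r ?addr0 //.
by field; rewrite a0 b0.
Qed.

(** By uniqueness of the Levi-Civita connection, it suffices that the right side is torsion-free and
    preserves [g']. *)
Lemma D_connection_mx k p : dom c p -> G' k p = G k p + deformation k p.
Proof.
move=> cp; have gu := metric_unit acm cp.
have eF := eta_phi acm cp.
have gT q : dom c q -> (g q)^T = g q by exact: metric_sym.
apply: (connection_mx_unique (fun q => @D_metric_sym q) (C := fun l => G l p +
  deformation l p) cp (D_metric_unit cp)) => [l i j|{}k].
  rewrite [LHS]mxE [RHS]mxE (connection_mxC gT l i j cp) !deformationE.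
  by rewrite [X in kappa * X]addrC (mulrC (e p 0 l)) (mulrC (e p 0 j)).
have he := eta_has_partial k cp.
have -> : partial_mx c k g' p = a *: partial_mx c k g p + (b ^+ 2 - a) *:
    ((partial_mx c k e p)^T *m e p + (e p)^T *m partial_mx c k e p).
  apply: has_partial_mxE; apply: has_partial_mxD; apply: has_partial_mxZ.
    exact: metric_has_partial.
  by apply: has_partial_mxM => //; exact: has_partial_mx_tr.
set A := deformation k p.
(* Hence [A] meets only the summand [a g] of [g'], not the one in [eta]. *)
have eA : e p *m A = 0.
  rewrite /A /deformation -scalemxAr mulmxDr -scalemxAr.
  by rewrite (mulmxA (e p) (F p)) eF mul0mx !(scaler0, addr0).
set W := g p *m F p; set u := row k (g p) *m F p.
have skew : W^T = - W.
  by rewrite trmx_mul (metric_sym acm cp) (metric_phi_skew acm cp).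
have uE : u = (delta_mx k 0)^T *m W by rewrite trmx_delta mulmxA -rowE.
have gA : a *: (g p *m A)
    = (alpha * (a - b ^+ 2)) *: (e p 0 k *: W - u^T *m e p).
  rewrite /A /deformation -scalemxAr scalerA mulmxDr -scalemxAr.
  rewrite uE trmx_mul trmxK skew !mulNmx opprK -mulmxA (mulmxA (g p)).
  by congr (_ *: _); rewrite /deformation_coef; field.
have gAT : (a *: (g p *m A))^T =
    (alpha * (a - b ^+ 2)) *: (- (e p 0 k *: W) - (e p)^T *m u).
  rewrite gA [LHS]linearZ /= linearB /= [(_ *: W)^T]linearZ /= skew scalerN.
  by rewrite trmx_mul trmxK.
(* The skew matrix [W] cancels. What remains is the contribution of the term [alpha u] of [d_k eta]
   to the derivative of [(b^2 - a) eta (x) eta]; this balance determines [kappa]. *)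
have gAs : a *: (A^T *m g p + g p *m A)
    = (alpha * (b ^+ 2 - a)) *: (u^T *m e p + (e p)^T *m u).
  rewrite scalerDr -[X in A^T *m X](metric_sym acm cp) -trmx_mul -linearZ /=.
  rewrite gAT gA -scalerDr addrACA addNr add0r -opprD scalerN -scaleNr.
  by rewrite [X in _ *: X]addrC; congr (_ *: _); ring.
clearbody A; set v := e p *m G k p.
have gGA : g' p *m (G k p + A)
    = a *: (g p *m G k p) + a *: (g p *m A) + (b ^+ 2 - a) *: ((e p)^T *m v).
  rewrite /= /tensor_prod mulmxDl -!scalemxAl -mulmxA (mulmxDr (e p)) eA addr0.
  by rewrite mulmxDr scalerDr.
rewrite -[X in _ = _ *m X + _](D_metric_sym cp) -trmx_mul gGA.
have -> : (a *: (g p *m G k p) + a *: (g p *m A) + (b ^+ 2 - a) *: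
    ((e p)^T *m v))^T = a *: ((G k p)^T *m g p) + a *: (A^T *m g p)
    + (b ^+ 2 - a) *: (v^T *m e p).
  rewrite 2!linearD /= ![(_ *: _)^T]linearZ /= !trmx_mul trmxK.
  by rewrite (metric_sym acm cp).
rewrite (metric_compatible gT k cp gu) (partial_eta k cp) -/u -/v.
rewrite [RHS]addrACA [X in _ = X + _]addrACA -(scalerDr a (A^T *m _)) gAs.
rewrite -(scalerDr a) -(scalerDr (b ^+ 2 - a)).
rewrite [(_ + v)^T]linearD /= [(_ *: _)^T]linearZ /= mulmxDl mulmxDr.
rewrite -scalemxAl -scalemxAr addrACA -scalerDr (scalerDr _ (alpha *: _)) scalerA addrA.
by rewrite [_ * alpha]mulrC.
Qed.

(** * Covariant derivative of the deformation, and the Ricci tensor of the new metric *)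

Lemma deformation_has_partial l k p : dom c p ->
  has_partial_mx c l (deformation k) p
    (kappa *: (partial_mx c l e p 0 k *: F p + e p 0 k *: partial_mx c l F p
      + (partial_mx c l F p *m (delta_mx k 0 *m e p)
         + F p *m (delta_mx k 0 *m partial_mx c l e p)))).
Proof.
move=> cp; have hF := phi_has_partial l cp; have he := eta_has_partial l cp.
apply: has_partial_mxZ; apply: has_partial_mxD.
  exact: has_partial_mxS cp (he 0 k) hF.
apply: has_partial_mxM => //.
have := has_partial_mxM cp
  (has_partial_mx_cst (M := M) c l (delta_mx k 0 : 'cV[R]_m) p) he.
by rewrite mul0mx add0r.
Qed.

(** The covariant derivative of [A(d_i, .)] along [d_k] as an endomorphism only. The omitted term
    [A(nabla_k d_i, .)] is symmetric in [k] and [i], so the alternation below is not affected. *)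
Definition nabla_deformation k i p : 'M[R]_m :=
  partial_mx c k (deformation i) p
  + (G k p *m deformation i p - deformation i p *m G k p).

Lemma nabla_deformationE k i p : dom c p -> nabla_deformation k i p = kappa *:
  ((alpha * (g p *m F p) k i + (e p *m G k p) 0 i) *: F p
   + (alpha * e p 0 i) *: nabla_phi k p
   + alpha *: (nabla_phi k p *m delta_mx i 0 *m e p)
   + F p *m col i (G k p) *m e p
   + alpha *: (F p *m delta_mx i 0 *m (row k (g p) *m F p))).
Proof.
move=> cp; rewrite /nabla_deformation.
rewrite (has_partial_mxE (deformation_has_partial k i cp)).
rewrite (partial_phi k cp) (partial_eta k cp) /deformation.
have -> : (alpha *: (row k (g p) *m F p) + e p *m G k p) 0 i
    = alpha * (g p *m F p) k i + (e p *m G k p) 0 i.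
  by rewrite mxDE mxZE -row_mul [row _ _ _ _]mxE.
move: (nabla_phi k p) ((g p *m F p) k i) ((e p *m G k p) 0 i) => P w t.
move: (G k p) (row k (g p)) => H r; rewrite colE.
rewrite !(mulmxDl, mulmxDr, mulmxBl, mulmxBr, mulNmx, mulmxN, =^~ scalemxAl,
  =^~ scalemxAr, mulmxA).
apply/matrixP => u v; rewrite !(mxDE, mxNE, mxZE); ring.
Qed.

(** The Christoffel symbols survive in [nabla_deformationE] only through [nabla_k d_i], which is
    symmetric, so the alternation is free of them. *)
Lemma nabla_deformation_alt k i p : dom c p ->
  nabla_deformation k i p - nabla_deformation i k p = (kappa * alpha) *:
  (((g p *m F p) k i - (g p *m F p) i k) *: F p
   + (e p 0 i *: nabla_phi k p - e p 0 k *: nabla_phi i p)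
   + (nabla_phi k p *m delta_mx i 0 *m e p
      - nabla_phi i p *m delta_mx k 0 *m e p)
   + (F p *m delta_mx i 0 *m (row k (g p) *m F p)
      - F p *m delta_mx k 0 *m (row i (g p) *m F p))).
Proof.
move=> cp; rewrite !nabla_deformationE //.
have gT q : dom c q -> (g q)^T = g q by exact: metric_sym.
have sG : col i (G k p) = col k (G i p).
  by apply/matrixP => r s; rewrite [LHS]mxE [RHS]mxE (connection_mxC gT).
have sv : (e p *m G k p) 0 i = (e p *m G i p) 0 k.
  rewrite [LHS]mxE [RHS]mxE; apply: eq_bigr => l _.
  by rewrite (connection_mxC gT).
rewrite sG sv.
apply/matrixP => u v; rewrite !(mxDE, mxNE, mxZE); ring.
Qed.

(** Products containing [eta phi] vanish, and the [phi^2] term with coefficient [eta_k eta_i] is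
    symmetric. *)
Lemma deformation_commutator k i p : dom c p ->
  deformation k p *m deformation i p - deformation i p *m deformation k p
  = kappa ^+ 2 *: (e p 0 k *: (F p *m F p *m delta_mx i 0 *m e p)
                   - e p 0 i *: (F p *m F p *m delta_mx k 0 *m e p)).
Proof.
move=> cp; have eF := eta_phi acm cp; rewrite /deformation.
rewrite !(mulmxDl, mulmxDr, =^~ scalemxAl, =^~ scalemxAr, mulmxA).
have z0 (A : 'cV[R]_m) : A *m e p *m F p = 0.
  by rewrite -mulmxA eF mulmx0.
rewrite !z0 !mul0mx !(scaler0, addr0).
apply/matrixP => u v; rewrite !(mxDE, mxNE, mxZE); ring.
Qed.

(** The curvature changes by the alternated [nabla_deformation] plus the commutator of the
    deformations. Its trace is assembled from the contractions of [phi], [xi], [eta] and [g]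
    prepared first. *)
Lemma D_ricci p : dom c p ->
  ricci (metric (D_homothety a b S)) c p = ricci (metric S) c p
  + (2 * kappa * alpha) *: g p
  + (kappa ^+ 2 * (m%:R - 1) - 2 * m%:R * kappa * alpha)
    *: tensor_prod (e p) (e p).
Proof.
move=> cp; have gT q : dom c q -> (g q)^T = g q by exact: metric_sym.
have sg : forall i j, smooth_in c (fun q => g q i j).
  by have [_ _ _ [[sg _] _ _] _] := acm; move=> i j; exact: sg.
have dG' k i : partial_mx c k (G' i) p
    = partial_mx c k (G i) p + partial_mx c k (deformation i) p.
  apply: has_partial_mxE.
  apply: (has_partial_mx_eq (F := fun q => G i q + deformation i q) cp).
    by move=> q cq; rewrite D_connection_mx.
  apply: has_partial_mxD.
    by apply: connection_mx_has_partial => // q cq; exact: metric_unit.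
  rewrite (has_partial_mxE (deformation_has_partial k i cp)).
  exact: deformation_has_partial.
apply/matrixP => i j.
pose W := g p *m F p.
have skew r s : W s r = - W r s.
  have : W^T = - W.
    by rewrite trmx_mul (metric_sym acm cp) (metric_phi_skew acm cp).
  by move/matrixP/(_ r s); rewrite !mxE.
have WF : \sum_k W i k * F p k j = - g p i j + e p 0 i * e p 0 j.
  have <- : (W *m F p) i j = \sum_k W i k * F p k j by rewrite mxE.
  rewrite -mulmxA (phi_sqr acm cp) mulmxDr mulmxN mulmx1 mulmxA.
  rewrite (metric_xi acm cp) mxDE mxNE; congr (_ + _).
  by rewrite mxE big_ord1 mxE.
have FW : \sum_k F p k i * W k j = g p i j - e p 0 i * e p 0 j.
  have <- : ((F p)^T *m W) i j = \sum_k F p k i * W k j.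
    by rewrite mxE; apply: eq_bigr => k _; rewrite mxE.
  rewrite mulmxA (metric_phi_phi acm cp) mxDE mxNE; congr (_ - _).
  by rewrite mxE big_ord1 mxE.
have xg l : \sum_k x p k 0 * g p k l = e p 0 l.
  rewrite -(xi_metric acm cp) mxE; apply: eq_bigr => k _; by rewrite mxE.
have ex : \sum_k e p 0 k * x p k 0 = 1.
  by have /matrixP/(_ 0 0) := eta_xi acm cp; rewrite !mxE.
have tF : \sum_k F p k k = 0 by exact: (tr_phi acm cp).
have tFF : \sum_k (F p *m F p) k k = 1 - m%:R by exact: (tr_phi_sqr acm cp).
have eFF : \sum_k e p 0 k * (F p *m F p) k i = 0.
  have <- : (e p *m (F p *m F p)) 0 i = \sum_k e p 0 k * (F p *m F p) k i.
    by rewrite mxE.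
  by rewrite mulmxA (eta_phi acm cp) mul0mx mxE.
have de : \sum_k (k == i)%:R * e p 0 k = e p 0 i.
  rewrite (bigD1 i) //= eqxx mul1r big1 ?addr0 // => k ki.
  by rewrite (negbTE ki) mul0r.
have one : \sum_(k < m) (1 : R) = m%:R by rewrite sumr_const card_ord.
have gE r s : g p r s = g p s r by rewrite -[in LHS](gT p cp) mxE.
have colrow (A : 'M[R]_m) (w : 'rV_m) r s t :
    (A *m (delta_mx r 0 : 'cV_m) *m w) s t = A s r * w 0 t.
  by rewrite -colE mxE big_ord1 mxE.
have PE l r s : nabla_phi l p r s = x p r 0 * g p l s - (r == l)%:R * e p 0 s.
  by rewrite mxDE mxNE mxE big_ord1 mxE mxE big_ord1 mxE andbT.
(* The mixed commutators of connection and deformation are absorbed into [nabla_deformation]. *)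
have summand k :
  (partial_mx c k (G' i) p - partial_mx c i (G' k) p
    + (G' k p *m G' i p - G' i p *m G' k p)) k j
  - (partial_mx c k (G i) p - partial_mx c i (G k) p
    + (G k p *m G i p - G i p *m G k p)) k j
  = (nabla_deformation k i p - nabla_deformation i k p
     + (deformation k p *m deformation i p
        - deformation i p *m deformation k p)) k j.
  rewrite !dG' !D_connection_mx // /nabla_deformation.
  move: (G k p) (G i p) (deformation k p) (deformation i p) => Gk Gi Ak Ai.
  move: (partial_mx c k (G i) p) (partial_mx c i (G k) p) => dGi dGk.
  move: (partial_mx c k _ p) (partial_mx c i _ p) => dAi dAk.
  rewrite !(mulmxDl, mulmxDr).
  by rewrite !(mxDE, mxNE); ring.
have ricci_diff : ricci (metric (D_homothety a b S)) c p i j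
    - ricci (metric S) c p i j = \sum_k
  (nabla_deformation k i p - nabla_deformation i k p
     + (deformation k p *m deformation i p
        - deformation i p *m deformation k p)) k j.
  apply: etrans (congr2 (fun u v => u - v) (ricciE _ _ _ _ _)
    (ricciE _ _ _ _ _)) _.
  rewrite -sumrB; by apply: eq_bigr => k _; exact: summand.
move: ricci_diff => /eqP; rewrite subr_eq => /eqP ->.
move: (ricci (metric S) c p) => r.
rewrite 2!mxDE 2!mxZE.
rewrite (_ : tensor_prod (e p) (e p) i j = e p 0 i * e p 0 j); last first.
  by rewrite /tensor_prod mxE big_ord1 mxE.
(* Each summand is a coefficient free of [k] times one of the contractions computed above; the
   explicit factor [1] lets the constant term sum to the dimension. *)
rewrite (eq_bigr (fun k =>
    kappa * alpha * (- 2) * (W i k * F p k j)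
  + kappa * alpha * e p 0 i * (x p k 0 * g p k j)
  + kappa * alpha * (- (2 * e p 0 i * e p 0 j)) * 1
  + kappa * alpha * (- g p i j) * (e p 0 k * x p k 0)
  + kappa * alpha * (2 * e p 0 j) * ((k == i)%:R * e p 0 k)
  + kappa * alpha * (F p k i * W k j)
  + kappa * alpha * (- W i j) * F p k k
  + kappa ^+ 2 * e p 0 j * (e p 0 k * (F p *m F p) k i)
  + kappa ^+ 2 * (- (e p 0 i * e p 0 j)) * (F p *m F p) k k)) => [|k _].
  rewrite !big_split -!mulr_sumr /= WF xg one ex de FW tF eFF tFF.
  ring.
rewrite nabla_deformation_alt // deformation_commutator //.
rewrite -/W.
have rowW l : (row l (g p) *m F p) 0 j = W l j by rewrite -row_mul mxE.
have [Pk Pi] := (PE k, PE i).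
move: (nabla_phi k p) (nabla_phi i p) Pk Pi => Pk Pi PkE PiE.
rewrite !(mxDE, mxNE, mxZE) !colrow !rowW !PkE !PiE eqxx mulr1n.
rewrite (skew i k) (gE i k); ring.
Qed.

End Deformation.

End Sasakian.

(** * Lie derivatives *)

Section LieDerivative.
Variables (R : realType) (m : nat) (M : manifold R m) (c : chart M).
Variables (X : vector_family M) (p : M).
Hypotheses (sX : smooth_local c (X c)) (cp : dom c p).

Lemma partialZ k (a : R) (f : M -> R) : smooth_in c f ->
  partial c k (fun q => a * f q) p = a * partial c k f p.
Proof.
move=> sf; exact: deriveZ (smooth_in_derivable cp sf).
Qed.

Lemma dirderZl t (Y : M -> 'cV[R]_m) (f : M -> R) :
  dirder c (fun q => t *: Y q) f p = t * dirder c Y f p.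
Proof.
by rewrite /dirder mulr_sumr; apply: eq_bigr => k _; rewrite mxE mulrA.
Qed.

Lemma dirderZr t (Y : M -> 'cV[R]_m) (f : M -> R) : smooth_in c f ->
  dirder c Y (fun q => t * f q) p = t * dirder c Y f p.
Proof.
move=> sf; rewrite /dirder mulr_sumr; apply: eq_bigr => k _.
by rewrite partialZ // mulrCA.
Qed.

Lemma bracketZ t j :
  bracket c (fun q => t *: X c q) (coord_field j) p
  = t *: bracket c (X c) (coord_field j) p.
Proof.
apply/matrixP => i l.
rewrite [LHS]mxE mxZE [X in t * X]mxE dirderZl mulrBr.
congr (_ - _).
have -> : (fun q => (t *: X c q) i 0) = fun q => t * X c q i 0.
  by apply/funext => q; rewrite mxE.
exact: dirderZr.
Qed.

Lemma pairingZl t (w : 'rV[R]_m) v : pairing (t *: w) v = t * pairing w v.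
Proof. by rewrite /pairing -scalemxAl mxE. Qed.

Lemma pairingZr t (w : 'rV[R]_m) v : pairing w (t *: v) = t * pairing w v.
Proof. by rewrite /pairing -scalemxAr mxE. Qed.

Lemma bilinZl t (B : 'M[R]_m) u v : bilin B (t *: u) v = t * bilin B u v.
Proof. by rewrite /bilin linearZ /= -!scalemxAl mxE. Qed.

Lemma bilinZr t (B : 'M[R]_m) u v : bilin B u (t *: v) = t * bilin B u v.
Proof. by rewrite /bilin -scalemxAr mxE. Qed.

Lemma bilinD a k (B C : 'M[R]_m) u v :
  bilin (a *: B + k *: C) u v = a * bilin B u v + k * bilin C u v.
Proof.
by rewrite /bilin mulmxDr mulmxDl -!scalemxAr -!scalemxAl mxDE !mxZE.
Qed.

Lemma bilin_tensor (w z : 'rV[R]_m) u v :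
  bilin (tensor_prod w z) u v = pairing w u * pairing z v.
Proof.
rewrite /bilin /tensor_prod mulmxA -trmx_mul -mulmxA mxE big_ord1.
by rewrite mxE.
Qed.

Lemma lie_formZl t (theta : covector_family M) :
  lie_form (fun d q => t *: X d q) theta c p = t *: lie_form X theta c p.
Proof.
apply/matrixP => i j.
rewrite [LHS]mxE mxZE [X in t * X]mxE dirderZl bracketZ pairingZr; ring.
Qed.

Lemma lie_formZr t (theta : covector_family M) :
  (forall j, smooth_in c (fun q => theta c q 0 j)) ->
  lie_form X (fun d q => t *: theta d q) c p = t *: lie_form X theta c p.
Proof.
move=> st; apply/matrixP => i j.
rewrite [LHS]mxE mxZE [X in t * X]mxE pairingZl.
have -> : (fun q => pairing (t *: theta c q) (coord_field j q))
    = fun q => t * pairing (theta c q) (coord_field j q).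
  by apply/funext => q; rewrite pairingZl.
rewrite dirderZr; first by rewrite mulrBr.
have -> : (fun q => pairing (theta c q) (coord_field j q))
    = fun q => theta c q 0 j by apply/funext => q; exact: pairing_delta.
exact: st.
Qed.

Lemma lie_bilinZ t (B : matrix_family M) :
  lie_bilin (fun d q => t *: X d q) B c p = t *: lie_bilin X B c p.
Proof.
apply/matrixP => i j.
rewrite [LHS]mxE mxZE [X in t * X]mxE dirderZl !bracketZ.
rewrite bilinZl bilinZr; ring.
Qed.

(** Leibniz rule for [theta (x) theta]; the factor [2] offsets the one half in [sym_prod]. *)
Lemma lie_bilin_tensor a k (B : matrix_family M) (theta : covector_family M) :
  (forall i j, smooth_in c (fun q => B c q i j)) ->
  (forall j, smooth_in c (fun q => theta c q 0 j)) ->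
  lie_bilin X (fun d q => a *: B d q
    + k *: tensor_prod (theta d q) (theta d q)) c p
  = a *: lie_bilin X B c p
    + (2 * k) *: sym_prod (lie_form X theta c p) (theta c p).
Proof.
move=> sB st; apply/matrixP => i j.
have hB l : has_partial_mx c l (B c) p (partial_mx c l (B c) p).
  exact: smooth_in_mx.
have ht l : has_partial_mx c l (theta c) p (partial_mx c l (theta c) p).
  by apply: smooth_in_mx => // r s; rewrite ord1.
have dT l : partial_mx c l (fun q => a *: B c q
    + k *: tensor_prod (theta c q) (theta c q)) p
  = a *: partial_mx c l (B c) p
    + k *: ((partial_mx c l (theta c) p)^T *m theta c p
    + (theta c p)^T *m partial_mx c l (theta c) p).
  apply: has_partial_mxE; apply: has_partial_mxD; apply: has_partial_mxZ => //.
  by apply: has_partial_mxM => //; exact: has_partial_mx_tr.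
have eB (C : matrix_family M) r s : (fun q => bilin (C c q) (coord_field r q)
    (coord_field s q)) = fun q => C c q r s.
  by apply/funext => q; exact: bilin_delta.
have et r : (fun q => pairing (theta c q) (coord_field r q))
    = fun q => theta c q 0 r.
  by apply/funext => q; exact: pairing_delta.
have dirT : dirder c (X c) (fun q => (a *: B c q
     + k *: tensor_prod (theta c q) (theta c q)) i j) p
   = a * dirder c (X c) (fun q => B c q i j) p
     + k * (dirder c (X c) (fun q => theta c q 0 i) p * theta c p 0 j
       + theta c p 0 i * dirder c (X c) (fun q => theta c q 0 j) p).
  rewrite /dirder !(mulr_sumr, mulr_suml) -!big_split /= !mulr_sumr -big_split.
  apply: eq_bigr => l _ /=.
  have /matrixP/(_ i j) := dT l; rewrite mxE => ->.
  rewrite !(mxDE, mxZE) !mxE !big_ord1 !mxE; ring.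
have sE (w : 'rV[R]_m) : sym_prod w (theta c p) i j
    = 2^-1 * (w 0 i * theta c p 0 j + theta c p 0 i * w 0 j).
  by rewrite /sym_prod /tensor_prod !mxE !big_ord1 !mxE.
rewrite [RHS]mxDE [X in _ = X + _]mxZE [X in _ = _ + X]mxZE sE.
rewrite [LHS]mxE [lie_bilin X B c p i j]mxE [lie_form X theta c p 0 i]mxE.
rewrite [lie_form X theta c p 0 j]mxE !et eB.
rewrite (eB (fun d q => a *: B d q + k *: tensor_prod (theta d q) (theta d q))).
rewrite dirT !bilinD !bilin_tensor /coord_field !pairing_delta.
by field.
Qed.

Lemma sym_prodZ s t (w z : 'rV[R]_m) :
  sym_prod (s *: w) (t *: z) = (s * t) *: sym_prod w z.
Proof.
apply/matrixP => i j; rewrite /sym_prod /tensor_prod !mxE !big_ord1 !mxE; ring.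
Qed.

Lemma tensor_prodZ s t (w z : 'rV[R]_m) :
  tensor_prod (s *: w) (t *: z) = (s * t) *: tensor_prod w z.
Proof.
apply/matrixP => i j; rewrite /tensor_prod !mxE !big_ord1 !mxE; ring.
Qed.

End LieDerivative.

(** * The soliton equation of the deformed structure *)

Theorem theorem4 (R : realType) (n : nat) (hn : (1 <= n)%N)
    (M : manifold R n.*2.+1) (hM : connected [set: M])
    (S : contact_data M) (alpha : R) (hS : alpha_sasakian alpha S)
    (hsol : twisted_eta_ricci_soliton S)
    (a b : R) (ha : 0 < a) (hb : 0 < b) :
  twisted_eta_ricci_soliton (D_homothety a b S).
Proof.
have [a0 b0] : a != 0 /\ b != 0 by rewrite !gt_eqF.
have [[_ _ [se _] [[sg _] _ _] _] _ _] := hS.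
have [X [lam [C1 [C2 [[sX tX] sol]]]]] := hsol.
pose kappa := deformation_coef alpha a b; pose d : R := (n.*2.+1)%:R.
pose r := 2 * kappa * alpha.
pose s := kappa ^+ 2 * (d - 1) - 2 * d * kappa * alpha.
(* Matches the coefficient of [g], which is [lam + r] on the left and [a lam'] on the right. *)
pose lam' := (lam + r) / a.
(* Division by [a] keeps the term in [L_X g] equal to that of the original equation. *)
exists (fun c p => a^-1 *: X c p), lam'.
(* The Lie derivative of [g'] adds [(b^2 - a) / a] to the coefficient [2 C1], and the symmetric
   product formed with [X'] and [eta'] is [b^2 / a] times the old one. *)
exists ((C1 + (b ^+ 2 - a) / (2 * a)) * a / b ^+ 2).
(* Here [lam' g'] already supplies [lam' (b^2 - a)] copies of [eta (x) eta], and [eta'] contributes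
   the factor [b^2]. *)
exists ((C2 + s - lam' * (b ^+ 2 - a)) / b ^+ 2).
split.
  split=> [c i|c d' p cp dp]; last by rewrite (tX c d' p cp dp) scalemxAr.
  have -> : (fun p => (a^-1 *: X c p) i 0) = fun p => a^-1 * X c p i 0.
    by apply/funext => p; rewrite mxE.
  exact: smooth_inZ.
move=> c p cp; have [solE etaX] := sol c p cp.
split; last by rewrite /= pairingZl pairingZr etaX !mulr0.
have sXc : smooth_local c (X c) by exact: sX.
rewrite (D_ricci hS a0 b0 cp) -/kappa -/d -/r -/s /=.
rewrite lie_bilinZ // lie_bilin_tensor // lie_formZl // lie_formZr //.
rewrite scalerA sym_prodZ tensor_prodZ.
move: solE; rewrite -[ricci _ _ _ + _ = _]/(_ = _).
move: (ricci _ _ _) (lie_bilin _ _ _ _) (sym_prod _ _) (tensor_prod _ _).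
move: (metric S c p) => g Ric L A T solE.
(* With the tensors made opaque, eliminating [Ric] by the given equation leaves a linear identity
   between entries. *)
have -> : Ric = lam *: g + (2 * C1) *: A + C2 *: T - 2^-1 *: L.
  by rewrite -solE addrK.
apply/matrixP => i j; rewrite !(mxDE, mxNE, mxZE) /lam'.
by field; rewrite a0 b0.
Qed.
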